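(* Let $F=F(X)$ be a non-abelian free group, and let $F_2=F(a,b)$ be the free group of rank $2$ on $\{a,b\}$. There is a monomorphism $\phi_0:F\to F_2$ into the free group of rank $2$ such that for any finitely generated subgroups $H,K\leqslant F$, the foldings $\Gamma_{H^{\phi_0}}$ and $\Gamma_{K^{\phi_0}}$ of the finitely generated subgroups $H^{\phi_0},K^{\phi_0}\leqslant F_2$ have the property that all their branch vertices are of degree $3$, and all degree $3$ vertices have the same type.
   Context: $F(X)$ is the free group on the set $X$, and $H^{\phi_0}$ denotes the image of $H$ under $\phi_0$. Folding: for a finitely generated subgroup $H=\langle w_1,\dots,w_n\rangle\leqslant F_2=F(a,b)$ (with $w_i$ nontrivial reduced words), the folding $\Gamma_H=(V_H,E_H)$ is the finite directed graph with edges labelled by $a,b$, with a base vertex $1_H$, obtained as follows. Take cycles $c_1,\dots,c_n$ with $|w_i|$ vertices in $c_i$, pick one vertex in each cycle and identify these to a single vertex $1_H$; label the edges of $c_i$ by the successive letters of $w_i$ starting at $1_H$ (a letter $x^{-1}$ corresponds to an edge labelled $x$ traversed backwards). Then repeatedly identify pairs of distinct edges with the same label and the same head or the same tail, until no such pair remains. The result does not depend on the generating set or on the order of the identifications. The folding of the trivial subgroup is the single vertex $1_H$ with no edges. Degree and type: the degree of a vertex is the number of incoming plus the number of outgoing edges at it (so a loop counts twice; degrees are at most $4$). A branch vertex is a vertex of degree at least $3$. At a vertex $v$, an outgoing edge labelled $x\in\{a,b\}$ is recorded as the letter $x$ and an incoming edge labelled $x$ as the letter $x^{-1}$; in a folding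 each of the four letters $a,a^{-1},b,b^{-1}$ is recorded at most once at $v$. The type of a degree $3$ vertex is determined by the set of three letters recorded at it (equivalently, by the one missing letter), so there are four types.
   Formalization: The set X is assumed to be countable (finite or countably infinite); for uncountable X the group F(X) is uncountable while F_2 is countable, so no monomorphism from F(X) into F_2 exists and the claim fails. *)

(* Defs.v *)
From HB Require Import structures.
From Stdlib Require Import Relation_Operators.
From mathcomp Require Import all_boot.
From mathcomp Require Import boolp classical_sets.

Set Implicit Arguments.
Unset Strict Implicit.
Unset Printing Implicit Defensive.

Import Algebra.

(* The letter [(x, true)] stands for x, and [(x, false)] for x^-1. *)
Definition letter (X : Type) : Type := (X * bool)%type.

Definition linv (X : Type) (l : letter X) : letter X := (l.1, ~~ l.2).

Section FreeGroup.
Variable X : choiceType.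
Implicit Types (l m : letter X) (u v w : seq (letter X)).

Definition reduced w : bool := sorted (fun l m => m != linv l) w.

Definition lcons l w : seq (letter X) :=
  if w is m :: w' then if m == linv l then w' else l :: w else [:: l].

Definition reduce w : seq (letter X) := foldr lcons [::] w.

Record free_group := FreeGroup { word :> seq (letter X); _ : reduced word }.

HB.instance Definition _ := [isSub for word].
HB.instance Definition _ := [Choice of free_group by <:].

Lemma linvK : involutive (@linv X).
Proof. by case=> x b; rewrite /linv /= negbK. Qed.

Lemma reduced_lcons l w : reduced w -> reduced (lcons l w).
Proof.
case: w => [|m w] //= pw; case: eqP => [_|/eqP ne]; first exact: path_sorted pw.
by rewrite /reduced /= ne.
Qed.

Lemma reduced_foldr u v : reduced v -> reduced (foldr lcons v u).
Proof. by move=> rv; elim: u => //= l u IHu; apply: reduced_lcons. Qed.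

Lemma reduced_reduce w : reduced (reduce w).
Proof. exact: reduced_foldr. Qed.

Lemma lconsK l w : reduced w -> lcons (linv l) (lcons l w) = w.
Proof.
case: w => [|m w] /=; first by rewrite linvK eqxx.
case: (eqVneq m (linv l)) => [-> | ne _] /=; last by rewrite linvK eqxx.
case: w => [|k w] //= /andP[ne _].
by rewrite (negPf ne).
Qed.

Lemma reduce_id w : reduced w -> reduce w = w.
Proof.
elim: w => //= l w IHw pw; rewrite /reduced /= in pw.
rewrite -/(reduce w) IHw; last exact: path_sorted pw.
by case: w pw {IHw} => //= m w /andP[/negPf-> _].
Qed.

Lemma foldr_lcons l u v : reduced v ->
  foldr lcons v (lcons l u) = lcons l (foldr lcons v u).
Proof.
case: u => [|m u] //= rv; case: eqP => [->|//].
by have := lconsK (linv l) (reduced_foldr u rv); rewrite linvK.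
Qed.

Lemma foldr_reduce u v : reduced v ->
  foldr lcons v (reduce u) = foldr lcons v u.
Proof. by move=> rv; elim: u => //= l u <-; rewrite foldr_lcons. Qed.

Lemma reduce_catl u v : reduce (reduce u ++ v) = reduce (u ++ v).
Proof. by rewrite /reduce !foldr_cat foldr_reduce ?reduced_reduce. Qed.

Lemma reduce_catr u v : reduce (u ++ reduce v) = reduce (u ++ v).
Proof. by rewrite /reduce !foldr_cat foldr_reduce. Qed.

Definition winv w : seq (letter X) := rev (map (@linv X) w).

Lemma reduced_winv w : reduced w -> reduced (winv w).
Proof.
rewrite /reduced /winv rev_sorted sorted_map.
apply: sub_sorted => l m /=; apply: contra => /eqP e.
by rewrite -(linvK m) -e.
Qed.

Lemma winvK : involutive winv.
Proof. by move=> w; rewrite /winv map_rev revK mapK //; apply: linvK. Qed.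

Lemma reduce_winv w : reduce (winv w ++ w) = [::].
Proof.
elim: w => // l w IHw.
rewrite /winv /= rev_cons cat_rcons /reduce foldr_cat /=.
by rewrite lconsK ?reduced_reduce // -foldr_cat.
Qed.

Definition fg_one : free_group := @FreeGroup [::] isT.
Definition fg_mul (u v : free_group) : free_group :=
  FreeGroup (reduced_reduce (u ++ v)).
Definition fg_inv (u : free_group) : free_group :=
  FreeGroup (reduced_winv (valP u)).

Lemma fg_mulA : associative fg_mul.
Proof.
by move=> u v w; apply: val_inj; rewrite /= reduce_catl reduce_catr catA.
Qed.

Lemma fg_mul1 : left_id fg_one fg_mul.
Proof. by move=> [u ru]; apply: val_inj; rewrite /= reduce_id. Qed.

Lemma fg_mulr1 : right_id fg_one fg_mul.
Proof. by move=> [u ru]; apply: val_inj; rewrite /= cats0 reduce_id. Qed.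

Lemma fg_mulV : left_inverse fg_one fg_inv fg_mul.
Proof. by move=> u; apply: val_inj; rewrite /= reduce_winv. Qed.

Lemma fg_mulrV : right_inverse fg_one fg_inv fg_mul.
Proof.
by move=> u; apply: val_inj; rewrite /= -{1}[word u]winvK reduce_winv.
Qed.

HB.instance Definition _ := isGroup.Build free_group
  fg_mulA fg_mul1 fg_mulr1 fg_mulV fg_mulrV.

End FreeGroup.

(* The free group of rank 2: the basis {a, b} is encoded as [bool]. *)
Notation F2 := (free_group bool).

Local Open Scope group_scope.
Local Open Scope classical_set_scope.

Definition subgroup (G : groupType) (H : set G) : Prop :=
  [/\ H 1, forall x y, H x -> H y -> H (x * y) & forall x, H x -> H x^-1].

Definition gen_by (G : groupType) (s : seq G) : set G :=
  smallest (@subgroup G) [set` s].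

Definition fin_gen_subgroup (G : groupType) (H : set G) : Prop :=
  exists s : seq G, H = gen_by s.

Local Close Scope classical_set_scope.

Record graph := Graph {
  vertex :> finType;
  edge : finType;
  tail : edge -> vertex;
  head : edge -> vertex;
  label : edge -> bool;
  base : vertex
}.

Section Wedge.
Variables (n : nat) (w : n.-tuple F2).

(* [None] is the common base vertex of the cycles; [Some (i, j)] is the vertex
   of the i-th cycle reached from the base after reading j + 1 letters. *)
Definition wedge_vertex : finType :=
  option {i : 'I_n & 'I_(size (tnth w i)).-1}.

Definition wedge_edge : finType := {i : 'I_n & 'I_(size (tnth w i))}.

(* The vertex of the i-th cycle reached after reading k letters, for
   0 <= k <= |w_i|; it is the base vertex for k = 0 and for k = |w_i|. *)
Definition wedge_pos (i : 'I_n) (k : nat) : wedge_vertex :=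
  if k is k'.+1 then
    omap (@Tagged _ i (fun i => 'I_(size (tnth w i)).-1)) (insub k')
  else None.

Definition wedge_letter (e : wedge_edge) : letter bool :=
  tnth (in_tuple (tnth w (tag e))) (tagged e).

Definition wedge : graph :=
  @Graph wedge_vertex wedge_edge
    (fun e => wedge_pos (tag e)
       (if (wedge_letter e).2 then tagged e : nat else (tagged e).+1))
    (fun e => wedge_pos (tag e)
       (if (wedge_letter e).2 then (tagged e).+1 else tagged e : nat))
    (fun e => (wedge_letter e).1)
    None.

End Wedge.

(* [f] is onto and identifies [x] with [y] and nothing else. *)
Definition identifies (S T : finType) (f : S -> T) (x y : S) : Prop :=
  (forall t, exists s, f s = t) /\
  (forall s s', f s = f s' <-> s = s' \/ [set s; s'] = [set x; y]).

(* [G'] is, up to isomorphism, the quotient of [G] identifying two distinct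
   edges with the same label and the same tail (resp. head), hence also their
   heads (resp. tails). *)
Definition fold_step (G G' : graph) : Prop :=
  exists (fV : G -> G') (fE : edge G -> edge G') (e1 e2 : edge G),
    [/\ e1 <> e2 /\ label e1 = label e2,
        identifies fE e1 e2,
        (tail e1 = tail e2 /\ identifies fV (head e1) (head e2)) \/
        (head e1 = head e2 /\ identifies fV (tail e1) (tail e2)),
        forall e, [/\ tail (fE e) = fV (tail e), head (fE e) = fV (head e)
                    & label (fE e) = label e]
      & fV (base G) = base G'].

Definition folded (G : graph) : Prop :=
  forall e1 e2 : edge G, label e1 = label e2 ->
    tail e1 = tail e2 \/ head e1 = head e2 -> e1 = e2.

Definition is_folding (H : set F2) (G : graph) : Prop :=
  exists (n : nat) (w : n.-tuple F2),
    [/\ forall i, tnth w i <> 1, H = gen_by w,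
        clos_refl_trans graph fold_step (wedge w) G & folded G].

Definition degree (G : graph) (v : G) : nat :=
  #|[set e : edge G | head e == v]| + #|[set e : edge G | tail e == v]|.

Definition branch (G : graph) (v : G) : Prop := 3 <= degree v.

Definition vertex_type (G : graph) (v : G) : {set letter bool} :=
  [set l | [exists e : edge G,
     (label e == l.1) && ((if l.2 then tail e else head e) == v)]].

Definition merge (T : eqType) (x y z : T) : T := if z == y then x else z.

Definition merged (T : finType) (x y : T) : finType :=
  {z : T | z \in codom (merge x y)}.

Definition to_merged (T : finType) (x y z : T) : merged x y :=
  Sub (merge x y z) (codom_f _ _).

Lemma to_merged_onto (T : finType) (x y : T) : identifies (@to_merged T x y) x y.
Proof.
split=> [[t tP] | s s'].
  by have /codomP[s es] := tP; exists s; apply: val_inj.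
have mE t t' : to_merged x y t = to_merged x y t' <->
    merge x y t = merge x y t'.
  by split=> [/(congr1 val) | e] //; apply: val_inj.
rewrite mE /merge; split.
  case: (eqVneq s y) => [->|sy]; case: (eqVneq s' y) => [->|s'y]; auto.
    by move=> <-; right; rewrite finset.setUC.
  by move=> ->; right.
case=> [-> // | /setP e]; have := e s; have := e s'; have := e x; have := e y.
rewrite !inE !eqxx ?orbT !(eq_sym x) !(eq_sym y).
by case: (eqVneq s y) => [->|sy]; case: (eqVneq s' y) => [->|s'y] //=;
   rewrite ?orbF ?orbT ?eqxx //= => *; apply/eqP; rewrite // eq_sym.
Qed.

Lemma merge_eq (T : eqType) (x y : T) : merge x y x = merge x y y.
Proof. by rewrite /merge eqxx; case: ifP. Qed.

Lemma card_merged (T : finType) (x y : T) : x != y -> #|merged x y| < #|T|.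
Proof.
move=> xy; rewrite card_sig; apply: (@leq_ltn_trans #|predC1 y|).
  apply/subset_leq_card/fintype.subsetP => z; rewrite !inE => /codomP[t ->].
  by rewrite /merge; case: (eqVneq t y) => [|//].
by rewrite cardC1 ltn_predL; apply/card_gt0P; exists x.
Qed.

Lemma fold_exists (G : graph) : exists2 G', clos_refl_trans graph fold_step G G'
  & folded G'.
Proof.
have [k] := ubnP #|edge G|; elim: k G => // k IHk G /ltnSE leG.
have [|nf] := pselect (folded G); first by exists G => //; apply: rt_refl.
have [e1 [e2 [e12 le] he]] : exists e1, exists2 e2 : edge G,
    e1 <> e2 /\ label e1 = label e2 & tail e1 = tail e2 \/ head e1 = head e2.
  apply: contrapT => ne; apply: nf => e1 e2 le he; apply: contrapT => e12.
  by apply: ne; exists e1, e2.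
have [x [y [hx tm hm]]] : exists x y,
  [/\ (tail e1 = tail e2 /\ (x, y) = (head e1, head e2)) \/
      (head e1 = head e2 /\ (x, y) = (tail e1, tail e2)),
      merge x y (tail e1) = merge x y (tail e2) &
      merge x y (head e1) = merge x y (head e2)].
  by case: he => he; [exists (head e1), (head e2)|exists (tail e1), (tail e2)];
     rewrite he merge_eq; split; auto.
pose G' := @Graph (merged x y) (merged e1 e2)
  (fun e => to_merged x y (tail (val e))) (fun e => to_merged x y (head (val e)))
  (fun e => label (val e)) (to_merged x y (base G)).
have st : fold_step G G'.
  exists (to_merged x y), (to_merged e1 e2), e1, e2; split=> //.
  - exact: to_merged_onto.
  - by case: hx => -[h [<- <-]]; [left|right]; split=> //; apply: to_merged_onto.
  move=> e; split; [apply: val_inj|apply: val_inj|];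
    by rewrite /= [merge e1 e2 e]/merge; case: eqP => [->|].
have [|G'' r f] := IHk G'.
  by apply: leq_trans leG; apply: card_merged; apply/eqP.
by exists G'' => //; apply: rt_trans r; apply: rt_step.
Qed.

Lemma folding_exists (H : set F2) : fin_gen_subgroup H -> exists G, is_folding H G.
Proof.
case=> s ->; pose t := [seq x <- s | x != 1 :> F2].
have [G r f] := fold_exists (wedge (in_tuple t)).
exists G, (size t), (in_tuple t); split=> //.
  move=> i; have := mem_tnth i (in_tuple t).
  by rewrite mem_filter => /andP[/eqP].
rewrite /gen_by /smallest; congr (\bigcap_(A in _) A)%classic.
apply/seteqP; split=> M [sM hM]; split=> // x.
  by rewrite /= mem_filter => /andP[_]; apply: hM.
have [-> _|x1 xs] := eqVneq x 1; first by case: sM.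
by apply: hM; rewrite /= mem_filter x1.
Qed.

(* Main.v *)
From HB Require Import structures.
Require Import Defs.
From Stdlib Require Import Relation_Operators.
From mathcomp Require Import all_boot.
From mathcomp Require Import boolp classical_sets.
Import Algebra.

(** A letter can be read at a vertex of a folding of a subgroup only if it can
be read at the image of that vertex in the folded graph of any larger
subgroup.  So it is enough to embed F(X) as a subgroup of F(a, b) whose own,
possibly infinite, folded graph has degrees at most 3 and a single type of
degree 3 vertices: every folding of the image of a subgroup inherits both
properties, because three letters at a vertex already exhaust the letters
available at its image.

The graph used here is an infinite ladder.  Its bottom rail is an infinite
ray of a-edges 0 -> 1 -> 2 -> ..., from each bottom vertex j a b-edge climbs
to a top vertex j, and for every i an a-edge joins top vertex 2i to top vertex
2i + 1.
<<
   top      0 --a--> 1         2 --a--> 3         4 --a--> 5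
            ^        ^         ^        ^         ^        ^
            b        b         b        b         b        b
            |        |         |        |         |        |
   bottom   0 --a--> 1 --a-->  2 --a--> 3 --a-->  4 --a--> 5 --a--> ...
>>
Top vertices have degree 2 and bottom vertices lack only the letter b^-1
(the bottom vertex 0 also lacks a^-1), as [ladder_type] records.  The
fundamental group at the bottom vertex 0 is free, with one generator
a^2i b a b^-1 a^-(2i+1) for each top edge; a countable set X is injected into
these generators by its enumeration.

The ladder is handled as a partial automaton whose transitions can be
reversed, so that whatever can be read survives free reduction
([run_reduce]).  Two facts are drawn from this.
- Reading the image of g along the ladder while recording which top edges are
  crossed gives back g ([run_embedding]).  This proves at once that the
  embedding is injective and that its values label loops at the bottom
  vertex 0.
- Since the words of the image label loops, the wedge of cycles on any of them
  maps to the ladder; the map survives each folding step because the ladder is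
  already folded ([folding_maps]).  In the folded graph the letters at a vertex
  are distinct, so the degree is bounded by the size of the type
  ([degree_le_type]), and the type is contained in the letters at the image
  ([vertex_type_step]). *)

Set Implicit Arguments.
Unset Strict Implicit.
Unset Printing Implicit Defensive.

(** * Words and substitutions in free groups *)

Section FreeGroupExtra.
Variable X : choiceType.
Implicit Types (l : letter X) (u v w : seq (letter X)).

Definition fg_word w : free_group X := FreeGroup (reduced_reduce w).

Lemma fg_word_cat u v : fg_word (u ++ v) = (fg_word u * fg_word v)%g.
Proof. by apply: val_inj; rewrite /= reduce_catl reduce_catr. Qed.

Lemma fg_word_nil : fg_word [::] = 1%g.
Proof. exact: val_inj. Qed.

Lemma fg_wordK (g : free_group X) : fg_word (word g) = g.
Proof. by apply: val_inj; rewrite /= reduce_id //; apply: valP. Qed.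

Lemma fg_word_winv w : (fg_word w * fg_word (winv w))%g = 1%g.
Proof.
rewrite -fg_word_cat; apply: val_inj.
by rewrite /= -{1}[w]winvK reduce_winv.
Qed.

Lemma reduce_winv_cat u v : reduce (winv u ++ u ++ v) = reduce v.
Proof. by rewrite catA -reduce_catl reduce_winv. Qed.

End FreeGroupExtra.

Section Substitution.
Variables (X Y : choiceType) (img : letter X -> seq (letter Y)).
Hypothesis imgV : forall l, img (linv l) = winv (img l).

Lemma reduce_img_reduce (w : seq (letter X)) :
  reduce (flatten (map img (reduce w))) = reduce (flatten (map img w)).
Proof.
elim: w => //= l w IHw; rewrite -reduce_catr -IHw reduce_catr -/(reduce w).
case: (reduce w) => [|m w'] //=; case: eqP => [->|//].
by rewrite /= imgV -{1}(winvK (img l)) reduce_winv_cat.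
Qed.

Definition substitution (g : free_group X) : free_group Y :=
  fg_word (flatten (map img (word g))).

Lemma substitutionM :
  {morph substitution : g h / (g * h)%g >-> (g * h)%g}.
Proof.
move=> g h; rewrite /substitution -fg_word_cat -flatten_cat -map_cat.
by apply: val_inj; rewrite /= reduce_img_reduce.
Qed.

End Substitution.

(** * Reversible partial automata *)

Section Automaton.
Variables (Y : choiceType) (S : Type) (step : S -> letter Y -> option S).

Definition reversible := forall s l t,
  step s l = Some t -> step t (linv l) = Some s.

Fixpoint run (s : S) (w : seq (letter Y)) : option S :=
  if w is l :: w' then obind (run^~ w') (step s l) else Some s.

Lemma run_cat s u v : run s (u ++ v) = obind (run^~ v) (run s u).
Proof. by elim: u s => //= l u IHu s; case: (step s l). Qed.

Lemma run_catS s u v t : run s u = Some t -> run s (u ++ v) = run t v.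
Proof. by rewrite run_cat => ->. Qed.

(** Cancelling l and l^-1 removes a detour along an edge and back; the converse
fails, as a word may be unreadable although its reduction is readable. *)
Lemma run_reduce s w t : reversible -> run s w = Some t ->
  run s (reduce w) = Some t.
Proof.
move=> stepV; elim: w s => //= l w IHw s; case E: (step s l) => [r|] //= /IHw.
rewrite -/(reduce w); case: (reduce w) => [|m w'] /=; first by rewrite E.
by case: eqP => [->|_] /=; rewrite ?(stepV _ _ _ E) ?E.
Qed.

Lemma run_take s w t k : run s w = Some t ->
  exists p, run s (take k w) = Some p.
Proof.
rewrite -{1}(cat_take_drop k w) run_cat.
by case: (run s (take k w)) => // p _; exists p.
Qed.

(** Voltages on the edges with values in a group define a covering graph: its
states pair a state with the product of the voltages met so far.  The voltages
are words, so that the inverse of a voltage is computed by [winv]. *)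
Section Voltage.
Variables (X : choiceType) (volt : S -> letter Y -> seq (letter X)).

Definition lift_step (sg : S * free_group X) (l : letter Y) :=
  omap (fun t => (t, sg.2 * fg_word (volt sg.1 l))%g) (step sg.1 l).

End Voltage.
End Automaton.

Lemma lift_reversible (X Y : choiceType) (S : Type)
    (step : S -> letter Y -> option S) (volt : S -> letter Y -> seq (letter X)) :
  reversible step ->
  (forall s l t, step s l = Some t -> volt t (linv l) = winv (volt s l)) ->
  reversible (lift_step step volt).
Proof.
move=> stepV voltV [s g] l [t h]; rewrite /lift_step /=.
case E: (step s l) => [r|] //= [rt <-]; rewrite -{t}rt (stepV _ _ _ E) /=.
by rewrite (voltV _ _ _ E) -mulgA fg_word_winv mulg1.
Qed.

Lemma run_lift (X Y : choiceType) (S : Type)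
    (step : S -> letter Y -> option S) (volt : S -> letter Y -> seq (letter X))
    s g w t h :
  run (lift_step step volt) (s, g) w = Some (t, h) -> run step s w = Some t.
Proof.
elim: w s g => [|l w IHw] s g /=; first by case=> ->.
by rewrite /lift_step /=; case: (step s l) => //= r /IHw.
Qed.

(** * Maps from foldings to an automaton *)

Section Folding.
Variables (S : Type) (step : S -> letter bool -> option S) (s0 : S).
Hypothesis stepV : reversible step.

Definition graph_morphism (G : graph) (f : G -> S) : Prop :=
  forall e, step (f (tail e)) (label e, true) = Some (f (Defs.head e)).

Definition maps (G : graph) : Prop := exists f : G -> S, graph_morphism f.

(** The image of the vertex reached after k letters of a cycle is the state
reached by reading these k letters; this is well defined at the base vertex
because each cycle reads as a loop. *)
Lemma wedge_maps (n : nat) (w : n.-tuple F2) :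
  (forall i, run step s0 (tnth w i) = Some s0) -> maps (wedge w).
Proof.
move=> closed.
(* All prefixes of a generator can be read, so the default is never used. *)
pose at_ i k := odflt s0 (run step s0 (take k (tnth w i))).
pose f (v : wedge w) : S := if v is Some (existT i j) then at_ i j.+1 else s0.
have fE i k : k <= size (tnth w i) -> f (wedge_pos w i k) = at_ i k.
  case: k => [|k] lek /=; first by rewrite /at_ take0.
  (* Beyond the inner vertices the position is the end of the cycle. *)
  case: insubP => [j _ <- //|]; rewrite -leqNgt => le; rewrite /= /at_.
  by rewrite take_oversize ?closed //; case: size le lek.
have atS i (j : 'I_(size (tnth w i))) : step (at_ i j) (tnth (in_tuple (tnth w i)) j)
    = Some (at_ i j.+1).
  have [p pE] := run_take j (closed i); have [q qE] := run_take j.+1 (closed i).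
  rewrite /at_ pE qE /=; move: qE.
  rewrite (tnth_nth (tnth (in_tuple (tnth w i)) j)) (take_nth (tnth (in_tuple (tnth w i)) j)) //.
  by rewrite -cats1 run_cat pE /=; case: step.
exists f => -[i j]; rewrite /= /wedge_letter /=.
have := atS i j; set l := tnth _ j => st; have jlt := ltn_ord j.
have fj := fE i j (ltnW jlt); have fSj := fE i j.+1 jlt.
case: l st => x [] /= st; rewrite ?fj ?fSj //.
exact: (stepV st).
Qed.

Lemma step_inj s s' l t :
  step s l = Some t -> step s' l = Some t -> s = s'.
Proof. by move=> /stepV st /stepV; rewrite st => -[]. Qed.

(** The two vertices identified by the step already have the same image, since
the two folded edges leave (or enter) one state along the same letter.  Hence
the map factors through the quotient. *)
Lemma fold_step_maps (G G' : graph) : fold_step G G' -> maps G -> maps G'.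
Proof.
case=> fV [fE [e1 [e2 [[_ le] [onE _] cases hom _]]]] [f fP].
have [x [y [[onV fVE] fxy]]] : exists x y, identifies fV x y /\ f x = f y.
  have := fP e1; have := fP e2; rewrite -le.
  case: cases => -[eq iV].
    by rewrite eq => -> [fh]; exists (Defs.head e1), (Defs.head e2).
  by rewrite eq => s2 s1; exists (tail e1), (tail e2); split=> //; apply: step_inj s1 s2.
(* Any section of the quotient map serves to descend f. *)
have [g gP] := choice onV.
have fg v : f (g (fV v)) = f v.
  have /fVE[-> // | /setP E] := gP (fV v).
  have := E v; have := E (g (fV v)); rewrite !inE !eqxx ?orbT.
  by case/esym/orP=> /eqP ->; case/esym/orP=> /eqP ->; rewrite ?fxy.
exists (f \o g) => e'; have [e <-] := onE e'.
by have [-> -> ->] := hom e; rewrite /= !fg.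
Qed.

Lemma folding_maps (H : set F2) (G : graph) :
  (forall u, H u -> run step s0 u = Some s0) -> is_folding H G -> maps G.
Proof.
move=> closed [n [w [_ HE red _]]].
have: maps (wedge w).
  apply: wedge_maps => i; apply: closed; rewrite HE.
  by apply: sub_gen_smallest; rewrite /= mem_tnth.
by elim: red => [G1 G2|//|G1 G2 G3 _ IH1 _ IH2 /IH1]; [apply: fold_step_maps|].
Qed.

Lemma vertex_type_step (G : graph) (f : G -> S) :
  graph_morphism f -> forall (v : G) l, l \in vertex_type v -> step (f v) l.
Proof.
move=> fP v [x b]; rewrite inE => /existsP[e /andP[/eqP /= <- /eqP <-]].
by case: b; [rewrite fP | rewrite (stepV (fP e))].
Qed.

End Folding.

(** In a folded graph an edge at v is determined by the letter it records. *)
Lemma degree_le_type (G : graph) (v : G) : folded G -> degree v <= #|vertex_type v|.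
Proof.
move=> fG; pose A b := [set e : edge G | (if b then tail e else Defs.head e) == v].
pose rec b := [set (label e, b) | e in A b].
have cardA b : #|A b| = #|rec b|.
  rewrite card_in_imset // => e1 e2; rewrite !inE => /eqP v1 /eqP v2 [le].
  by apply: fG => //; case: b v1 v2 => -> ->; auto.
rewrite /degree -/(A false) -/(A true) !cardA -cardsUI [X in _ + X]eq_card0; last first.
  by move=> l; rewrite !inE; apply/andP => -[/imsetP[e _ ->] /imsetP[e' _ []]].
rewrite addn0; apply/subset_leq_card/fintype.subsetP => l.
by rewrite !inE => /orP[] /imsetP[e]; rewrite !inE => /eqP ev ->;
  apply/existsP; exists e; rewrite eqxx /= ev.
Qed.

(** * The ladder *)

Local Notation a_ := true (only parsing).
Local Notation b_ := false (only parsing).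

(** The boolean tells whether the vertex is on the top side. *)
Definition ladder_vertex : Type := (nat * bool)%type.

Definition ladder (v : ladder_vertex) (l : letter bool) : option ladder_vertex :=
  match v, l with
  | (j, false), (a_, true) => Some (j.+1, false)
  | (j, false), (a_, false) => if j is i.+1 then Some (i, false) else None
  | (j, false), (b_, true) => Some (j, true)
  | (j, true), (b_, false) => Some (j, false)
  | (j, true), (a_, true) => if odd j then None else Some (j.+1, true)
  | (j, true), (a_, false) => if odd j then Some (j.-1, true) else None
  | _, _ => None
  end.

Lemma ladder_reversible : reversible ladder.
Proof.
case=> j [] [[] []] t //=.
- by case: ifP => // /negbT oj [<-] /=; rewrite oj.
- by case: j => // j; case: ifP => // /= oj [<-] /=; rewrite (negPf oj).
- by case=> <-.
- by case=> <-.
- by case: j => // j [<-].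
by case=> <-.
Qed.

(** The letters at a top vertex are b^-1 and one of a, a^-1; those at a bottom
vertex are among a, a^-1, b.  So three letters at one vertex can only be the
latter. *)
Lemma ladder_type (v : ladder_vertex) (A : {set letter bool}) :
  (forall l, l \in A -> ladder v l) -> 3 <= #|A| ->
  A = [set~ (b_, false)].
Proof.
case: v => j [] stA A3.
  suff /subset_leq_card : A \subset [set (a_, ~~ odd j); (b_, false)].
    by rewrite cards2 leqNgt A3.
  apply/fintype.subsetP => -[[] []] /stA; rewrite !inE //=.
    by case: odd.
  by case: j {stA} => //= j; case: odd.
apply/eqP; rewrite eqEcard; apply/andP; split.
  by apply/fintype.subsetP => -[[] []] /stA; rewrite !inE.
by rewrite cardsC1 card_prod card_bool.
Qed.

(** * The embedding *)

Section Embedding.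
Variable X : countType.
Implicit Types (l : letter X) (g : free_group X).

(** The rung by which the path of the letter l climbs to the top side.  It is
also the rung by which the path of l^-1 comes down, so that the path of
x^-1 is the path of x traversed backwards. *)
Definition rung l : nat := (pickle l.1).*2 + ~~ l.2.

Definition letter_path l : seq (letter bool) :=
  nseq (rung l) (a_, true) ++ [:: (b_, true); (a_, l.2); (b_, false)]
    ++ nseq (rung (linv l)) (a_, false).

Lemma letter_path_linv l : letter_path (linv l) = winv (letter_path l).
Proof.
rewrite /winv /letter_path linvK !map_cat !map_nseq !rev_cat !rev_nseq /=.
by rewrite -catA.
Qed.

(** The edge from top vertex 2i to top vertex 2i + 1 carries the element of X of
index i, the common half of 2i and 2i + 1.  Indices without an element of X,
and all the other edges, carry the trivial word. *)
Definition voltage (v : ladder_vertex) (l : letter bool) : seq (letter X) :=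
  if v.2 && l.1 then
    if unpickle v.1./2 is Some x then [:: (x, l.2)] else [::]
  else [::].

Lemma voltage_linv v (l : letter bool) t : ladder v l = Some t ->
  voltage t (linv l) = winv (voltage v l).
Proof.
have E j : ~~ odd j -> uphalf j = j./2 by move=> oj; rewrite uphalf_half (negPf oj).
case: v l => j [] [[] []] //=.
- case: ifP => // /negbT /E oj [<-]; rewrite /voltage /= oj.
  by case: unpickle.
- case: j => // j; case: ifP => // /= /E oj [<-]; rewrite /voltage /= oj.
  by case: unpickle.
- by case=> <-.
- by case=> <-.
- by case: j => // j [<-].
by case=> <-.
Qed.

Definition ladder_cover := lift_step ladder voltage.

Lemma ladder_cover_reversible : reversible ladder_cover.
Proof. exact: lift_reversible ladder_reversible voltage_linv. Qed.

Lemma run_rail j i g b w : ladder (j, false) (a_, b) = Some (i, false) ->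
  run ladder_cover ((j, false), g) ((a_, b) :: w) = run ladder_cover ((i, false), g) w.
Proof.
move=> st; have st1 : ladder_cover ((j, false), g) (a_, b) = Some ((i, false), g).
  by rewrite /ladder_cover /lift_step st /= fg_word_nil mulg1.
by rewrite -[LHS]/(obind _ (ladder_cover ((j, false), g) (a_, b))) st1.
Qed.

Lemma run_rail_up j g n :
  run ladder_cover ((j, false), g) (nseq n (a_, true)) = Some ((n + j, false), g).
Proof.
by elim: n j => // n IHn j; rewrite [nseq _ _]/= (run_rail _ (i := j.+1)) // IHn addnS.
Qed.

Lemma run_rail_down j g n :
  run ladder_cover ((n + j, false), g) (nseq n (a_, false)) = Some ((j, false), g).
Proof.
by elim: n => // n IHn; rewrite [nseq _ _]/= (run_rail _ (i := n + j)) // IHn.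
Qed.

(** The rails carry no voltage, and the only top edge crossed is that of l. *)
Lemma run_letter_path g l :
  run ladder_cover ((0, false), g) (letter_path l)
    = Some ((0, false), (g * fg_word [:: l])%g).
Proof.
have cross : run ladder_cover ((rung l, false), g) [:: (b_, true); (a_, l.2); (b_, false)]
    = Some ((rung (linv l), false), (g * fg_word [:: l])%g).
  case: l => x []; rewrite /rung /ladder_cover /lift_step /voltage /= ?addn0 ?addn1 /= odd_double /=.
    by rewrite doubleK pickleK /= fg_word_nil !mulg1.
  by rewrite uphalf_double pickleK /= fg_word_nil !mulg1.
rewrite (run_catS _ (run_rail_up _ _ _)) addn0 (run_catS _ cross).
by rewrite -{1}(addn0 (rung (linv l))) run_rail_down.
Qed.

Lemma run_letter_paths g (w : seq (letter X)) :
  run ladder_cover ((0, false), g) (flatten (map letter_path w))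
    = Some ((0, false), (g * fg_word w)%g).
Proof.
elim: w g => [|l w IHw] g; first by rewrite /= fg_word_nil mulg1.
by rewrite /= run_cat run_letter_path /= IHw -mulgA -fg_word_cat.
Qed.

Definition embedding : free_group X -> F2 := substitution letter_path.

HB.instance Definition _ :=
  isMultiplicative.Build _ _ embedding (substitutionM letter_path_linv).

(** The word of [embedding g] is only the reduction of the concatenated letter
paths, but reduction does not change the end of a run. *)
Lemma run_embedding g :
  run ladder_cover ((0, false), 1%g) (embedding g) = Some ((0, false), g).
Proof.
by apply/run_reduce; [exact: ladder_cover_reversible|rewrite run_letter_paths mul1g fg_wordK].
Qed.

Lemma embedding_inj : injective embedding.
Proof.
by move=> g h e; have := run_embedding g; rewrite e run_embedding => -[].
Qed.

Lemma embedding_folding (H : set (free_group X)) (G : graph) :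
  is_folding (embedding @` H)%classic G ->
  forall v : G, branch v -> degree v = 3 /\ vertex_type v = [set~ (b_, false)].
Proof.
move=> GH v v3; have : maps ladder G.
  apply: (folding_maps (s0 := (0, false)) ladder_reversible _ GH).
  by move=> _ [g _ <-]; apply: run_lift (run_embedding g).
case=> f fP.
have vle : degree v <= #|vertex_type v|.
  by case: GH => [n [w [_ _ _ fG]]]; apply: degree_le_type.
have vE : vertex_type v = [set~ (b_, false)].
  apply: (ladder_type (v := f v)) (leq_trans v3 vle) => l.
  exact: (vertex_type_step ladder_reversible fP).
split=> //; apply/eqP; rewrite eqn_leq; apply/andP; split=> //.
by rewrite (leq_trans vle) // vE cardsC1 card_prod card_bool.
Qed.

End Embedding.

Unset Implicit Arguments.

Theorem theorem3 (X : countType)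
  (nonabelian : exists u v : free_group X, (u * v <> v * u)%g) :
  exists phi : {multiplicative free_group X -> F2},
    injective phi /\
    forall H K : set (free_group X),
      fin_gen_subgroup H -> fin_gen_subgroup K ->
      forall GH GK : graph,
        is_folding (phi @` H)%classic GH -> is_folding (phi @` K)%classic GK ->
        [/\ forall v : GH, branch v -> degree v = 3,
            forall v : GK, branch v -> degree v = 3
          & exists t : {set letter bool},
              (forall v : GH, degree v = 3 -> vertex_type v = t) /\
              (forall v : GK, degree v = 3 -> vertex_type v = t)].
Proof.
exists (@embedding X); split; first exact: embedding_inj.
move=> H K _ _ GH GK /embedding_folding FH /embedding_folding FK.
split=> [v /FH[] //|v /FK[] //|].
exists [set~ (b_, false)].
by split=> v v3; [case: (FH v)|case: (FK v)] => //; rewrite /branch v3.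
Qed.
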